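(* Let $m\ge n\ge2$ and let $I$ be the cover ideal of the graph $A_{n,m}$. Then $I$ is quasi-equigenerated and: (1) The analytic spread of $I$ is $n+m-2$. (2) $I$ is a Freiman ideal if and only if $n\le3$.
   Context: $A_{n,m}$ is the simple graph consisting of complete graphs on $n$ and $m$ vertices sharing exactly one vertex: its vertex set is $\{x_1,\dots,x_n,y_2,\dots,y_m\}$ and its edges are all $\{x_i,x_j\}$ with $1\le i<j\le n$, all $\{y_i,y_j\}$ with $2\le i<j\le m$, and all $\{x_n,y_j\}$ with $2\le j\le m$. Vertices of a graph $G$ are identified with the variables of a polynomial ring $R$ over a field $k$; the cover ideal is $J(G)=\bigcap_{\{u,v\}\in E(G)}(u,v)\subseteq R$. A monomial ideal $I$ of $R=k[z_1,\dots,z_N]$ with minimal monomial generators $f_1,\dots,f_t$, $f_j=\prod_i z_i^{c_{ij}}$, is quasi-equigenerated if there are positive integers $a_1,\dots,a_N$ such that $\sum_i a_i c_{ij}$ is the same for all $j$. The fiber cone is $F(I)=\bigoplus_{i\ge0}I^i/\mathfrak m I^i$ with $\mathfrak m$ the homogeneous maximal ideal; the analytic spread $l(I)$ is the Krull dimension of $F(I)$; $\mu(\cdot)$ is the minimal number of generators. A quasi-equigenerated monomial ideal $I$ is a Freiman ideal if $\mu(I^2)=l(I)\mu(I)-\binom{l(I)}{2}$. *)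

(* Defs.v *)
From HB Require Import structures.
From mathcomp Require Import all_boot all_order all_algebra.
From mathcomp Require Import boolp.
From mathcomp Require Import ring_quotient.
From mathcomp Require Import mpoly.

Set Implicit Arguments.
Unset Strict Implicit.
Unset Printing Implicit Defensive.

Import GRing.Theory.
Local Open Scope ring_scope.

(* Ideals are boolean predicates, compared extensionally with [=i]; [asbool]
   (classical) turns an arbitrary Prop-valued predicate into such a one. *)

Section Ideals.
Variable R : comNzRingType.
Implicit Types (S : R -> Prop) (I J : {pred R}).

Definition ideal_gen S : {pred R} :=
  [pred f | `[< exists2 s : seq (R * R),
                  forall p, p \in s -> S p.2 & f = \sum_(p <- s) p.1 * p.2 >]].

Definition ideal_mul I J : {pred R} :=
  ideal_gen (fun f => exists a b, [/\ a \in I, b \in J & f = a * b]).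

Definition ideal_exp I (i : nat) : {pred R} :=
  iter i (ideal_mul I) predT.

Definition has_min_gens I (r : nat) : Prop :=
  (exists2 s : seq R, size s = r & I =i ideal_gen (fun f => f \in s)) /\
  (forall s : seq R, I =i ideal_gen (fun f => f \in s) -> (r <= size s)%N).

Lemma ideal_gen_in S f : S f -> f \in ideal_gen S.
Proof.
move=> Sf; apply/asboolP; exists [:: (1, f)].
  by move=> p; rewrite inE => /eqP ->.
by rewrite big_seq1 mul1r.
Qed.

Lemma ideal_gen0 S : 0 \in ideal_gen S.
Proof. by apply/asboolP; exists [::]; rewrite ?big_nil. Qed.

Lemma ideal_genD S f g :
  f \in ideal_gen S -> g \in ideal_gen S -> f + g \in ideal_gen S.
Proof.
move=> /asboolP[s hs ->] /asboolP[t ht ->]; apply/asboolP; exists (s ++ t).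
  by move=> p; rewrite mem_cat => /orP[/hs|/ht].
by rewrite big_cat.
Qed.

Lemma ideal_genM S a f : f \in ideal_gen S -> a * f \in ideal_gen S.
Proof.
move=> /asboolP[s hs ->]; apply/asboolP.
exists [seq (a * p.1, p.2) | p <- s].
  by move=> p /mapP[q /hs hq ->].
by rewrite big_map mulr_sumr; apply: eq_bigr => p _; rewrite mulrA.
Qed.

Lemma ideal_genN S f : f \in ideal_gen S -> - f \in ideal_gen S.
Proof. by rewrite -mulN1r; apply: ideal_genM. Qed.

Lemma ideal_gen_sum S T (r : seq T) (P : pred T) (F : T -> R) :
  (forall i, P i -> F i \in ideal_gen S) ->
  \sum_(i <- r | P i) F i \in ideal_gen S.
Proof.
by move=> h; elim/big_ind: _ => //; [apply: ideal_gen0|apply: ideal_genD].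
Qed.

Lemma ideal_gen_min S S' f :
  (forall g, S g -> g \in ideal_gen S') ->
  f \in ideal_gen S -> f \in ideal_gen S'.
Proof.
move=> h /asboolP[s hs ->]; rewrite big_seq; apply: ideal_gen_sum => p ps.
by apply: ideal_genM; apply: h; apply: hs.
Qed.

Lemma ideal_mul_in I J f g : f \in I -> g \in J -> f * g \in ideal_mul I J.
Proof. by move=> If Jg; apply: ideal_gen_in; exists f, g. Qed.

Lemma ideal_exp0 I i : 0 \in ideal_exp I i.
Proof. by case: i => [|i] //; apply: ideal_gen0. Qed.

Lemma ideal_expD I i f g :
  f \in ideal_exp I i -> g \in ideal_exp I i -> f + g \in ideal_exp I i.
Proof. by case: i => [|i] //; apply: ideal_genD. Qed.

Lemma ideal_expN I i f : f \in ideal_exp I i -> - f \in ideal_exp I i.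
Proof. by case: i => [|i] //; apply: ideal_genN. Qed.

Lemma ideal_expM I i a f : f \in ideal_exp I i -> a * f \in ideal_exp I i.
Proof. by case: i => [|i] //; apply: ideal_genM. Qed.

Lemma ideal_exp_mul I i j f g :
  f \in ideal_exp I i -> g \in ideal_exp I j ->
  f * g \in ideal_exp I (i + j).
Proof.
elim: i f => [|i IH] f; first by move=> _; apply: ideal_expM.
move=> /asboolP[s hs ->] gj; rewrite addSn big_seq mulr_suml.
apply: ideal_gen_sum => p /hs [a [b [Ia Ib ->]]].
rewrite -mulrA; apply: ideal_genM; rewrite -mulrA.
by apply: ideal_mul_in => //; apply: IH.
Qed.

Definition prime_ideal (P : {pred R}) : Prop :=
  idealr_closed P /\ prime_idealr_closed P.

Definition prime_chain (d : nat) (P : 'I_d.+1 -> {pred R}) : Prop :=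
  (forall i, prime_ideal (P i)) /\
  (forall i j : 'I_d.+1, (i < j)%N ->
     {subset P i <= P j} /\ ~ {subset P j <= P i}).

End Ideals.

Definition has_krull_dim (R : comNzRingType) (d : nat) : Prop :=
  (exists P : 'I_d.+1 -> {pred R}, prime_chain P) /\
  (forall e (P : 'I_e.+1 -> {pred R}), prime_chain P -> (e <= d)%N).

(* The fiber cone of I is the Rees algebra, whose elements are the polynomials
   f_0 + f_1 t + ... + f_s t^s with f_i in I^i, modulo the ideal of those with
   f_i in m I^i for all i. *)
Section FiberCone.
Variables (k : fieldType) (N : nat).
Local Notation R := {mpoly k[N]}.

Definition max_ideal : {pred R} := ideal_gen (fun f => exists i, f = 'X_i).

Variable I : {pred R}.

Definition rees_pred : {pred {poly R}} :=
  [pred p : {poly R} | `[< forall i, p`_i \in ideal_exp I i >]].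

Lemma rees_subring_closed : subring_closed rees_pred.
Proof.
split.
- by apply/asboolP=> i; rewrite coef1; case: i => [|i] //; apply: ideal_exp0.
- move=> p q /asboolP hp /asboolP hq; apply/asboolP=> i.
  by rewrite coefB; apply: ideal_expD => //; apply: ideal_expN.
move=> p q /asboolP hp /asboolP hq; apply/asboolP=> i.
rewrite coefM; elim/big_ind: _ => [||j _]; first exact: ideal_exp0.
  by move=> f g; apply: ideal_expD.
by rewrite -[in ideal_exp I i](subnKC (leq_ord j)); apply: ideal_exp_mul.
Qed.

HB.instance Definition _ :=
  GRing.isSubringClosed.Build {poly R} rees_pred rees_subring_closed.

Record rees : Type := Rees { rees_val : {poly R}; _ : rees_val \in rees_pred }.

HB.instance Definition _ := [isSub for rees_val].
HB.instance Definition _ := [Choice of rees by <:].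
HB.instance Definition _ := [SubChoice_isSubComNzRing of rees by <:].

Definition rees_max_pred : {pred rees} :=
  [pred p : rees |
    `[< forall i, (rees_val p)`_i \in ideal_mul max_ideal (ideal_exp I i) >]].

Lemma one_notin_max : (1 : R) \notin ideal_mul max_ideal (ideal_exp I 0).
Proof.
suff h f : f \in ideal_mul max_ideal (ideal_exp I 0) -> f.@[fun=> 0] = 0.
  by apply/negP => /h; rewrite meval1; apply/eqP; rewrite oner_eq0.
move=> /asboolP[s hs ->]; rewrite big_seq raddf_sum big1 //= => p /hs.
move=> [a [b [/asboolP[t ht ->] _ ->]]]; rewrite !mevalM.
rewrite big_seq raddf_sum big1 /= ?mul0r ?mulr0 // => q /ht [i ->].
by rewrite mevalM mevalXU mulr0.
Qed.

Lemma rees_max_idealr_closed : idealr_closed rees_max_pred.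
Proof.
split.
- by apply/asboolP=> i; rewrite [rees_val 0](raddf0 val) coef0; apply: ideal_gen0.
- apply/negP => /asboolP/(_ 0%N).
  by rewrite [rees_val 1](rmorph1 val) coef1; apply/negP/one_notin_max.
move=> a u v /asboolP hu /asboolP hv; apply/asboolP=> i.
have -> : rees_val (a * u + v) = rees_val a * rees_val u + rees_val v.
  by rewrite [LHS](raddfD val); congr (_ + _); apply: (rmorphM val).
rewrite coefD; apply: ideal_genD => //.
rewrite coefM; apply: ideal_gen_sum => j _; case: a => a /= /asboolP ha.
move: (hu (i - j)%N) => /asboolP[s hs ->].
rewrite big_seq mulr_sumr; apply: ideal_gen_sum => p /hs [x [y [mx Iy ->]]].
rewrite mulrCA; apply: ideal_genM; rewrite mulrCA; apply: ideal_mul_in => //.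
by rewrite -[in ideal_exp I i](subnKC (leq_ord j)); apply: ideal_exp_mul.
Qed.

HB.instance Definition _ :=
  isIdealr.Build rees rees_max_pred rees_max_idealr_closed.

Definition fiber_cone : comNzRingType := {ideal_quot rees_max_pred}.

Definition has_analytic_spread (l : nat) : Prop := has_krull_dim fiber_cone l.

End FiberCone.

Section Monomial.
Variables (k : fieldType) (N : nat).
Local Notation R := {mpoly k[N]}.

Definition monomial_ideal (G : seq 'X_{1..N}) : {pred R} :=
  ideal_gen (fun f => exists2 c, c \in G & f = 'X_[c]).

Definition min_monomial_gens (I : {pred R}) (G : seq 'X_{1..N}) : Prop :=
  I =i monomial_ideal G /\
  (forall G' : seq 'X_{1..N}, {subset G' <= G} -> I =i monomial_ideal G' ->
     {subset G <= G'}).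

Definition quasi_equigenerated (I : {pred R}) : Prop :=
  exists2 G : seq 'X_{1..N}, min_monomial_gens I G &
  exists2 a : 'I_N -> nat, forall i, (0 < a i)%N &
  {in G &, forall c c' : 'X_{1..N},
     (\sum_i a i * c i = \sum_i a i * c' i)%N}.

Definition freiman (I : {pred R}) : Prop :=
  quasi_equigenerated I /\
  exists l mu mu2 : nat,
    [/\ has_analytic_spread I l, has_min_gens I mu,
        has_min_gens (ideal_exp I 2) mu2 &
        mu2%:Z = l%:Z * mu%:Z - 'C(l, 2)%:Z].

Definition cover_ideal (e : rel 'I_N) : {pred R} :=
  [pred f : R | [forall u, forall v,
     e u v ==> (f \in ideal_gen (fun g : R => g = 'X_u \/ g = 'X_v))]].

End Monomial.

Arguments cover_ideal k {N} e.

(* The vertex [lshift _ i] is x_(i+1), and [rshift _ j] is y_(j+2). *)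
Definition Agraph (n m : nat) : rel 'I_(n + m.-1) := fun u v =>
  match split u, split v with
  | inl i, inl j => i != j
  | inr i, inr j => i != j
  | inl i, inr _ | inr _, inl i => i == n.-1 :> nat
  end.

Arguments Agraph : clear implicits.

Lemma Agraph_sym n m : ssrbool.symmetric (Agraph n m).
Proof.
by move=> u v; rewrite /Agraph; case: (split u) (split v) => i [] j //;
  rewrite eq_sym.
Qed.

Lemma Agraph_irrefl n m : irreflexive (Agraph n m).
Proof. by move=> u; rewrite /Agraph; case: (split u) => i; rewrite eqxx. Qed.

(* Main.v *)
(* Put p = n - 1 and q = m - 1. The maximal independent sets of A_{n,m} are the
   shared vertex alone and the pairs {x_i, y_j}, so I is minimally generated by the
   p q + 1 squarefree monomials supported on the complement of such a set.
   Giving the shared vertex weight 2 and every other vertex weight 1 puts all generators in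
   weight p + q. Hence the fiber cone is the monomial algebra spanned, in degree i, by the i-fold products of generators.
   Lower bound on its dimension: the faces of its exponent cone give a chain of
   p + q + 1 primes. Upper bound: along a chain P_0 < ... < P_e of primes, elements
   x_i of P_{i+1} outside P_i have the s^e monomials with exponents below s linearly
   independent modulo P_0, all in degree O(s); but products of at most t generators
   give at most (t+1)^(p+q) exponent vectors, so e <= p + q.
   The square of I has 1 + p q + C(p+1,2) C(q+1,2) minimal generators, and this
   exceeds the Freiman bound by (p-1)(p-2)(q-1)(q-2)/4. *)
Require Import Defs.
From mathcomp Require Import all_boot all_order all_algebra.
From mathcomp Require Import boolp.
From mathcomp Require Import generic_quotient ring_quotient.
From mathcomp Require Import mpoly.
From mathcomp Require Import zify.

Set Implicit Arguments.
Unset Strict Implicit.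
Unset Printing Implicit Defensive.

Import GRing.Theory.
Local Open Scope ring_scope.

(** * Primes of a quotient and independent families along a chain of primes *)

Section Quotient.
Variables (A : comNzRingType) (a : idealr A).
Local Notation Q := {ideal_quot a}.

Lemma quot_pi0 (x : A) : x \in (a : {pred A}) -> \pi_Q%qT x = 0.
Proof.
by move=> ax; apply/eqP; rewrite -(rmorph0 \pi_Q%qT) -Quotient.idealrBE subr0.
Qed.

Lemma repr_piB (x : A) : repr (\pi_Q%qT x) - x \in (a : {pred A}).
Proof. by rewrite Quotient.idealrBE reprK. Qed.

Lemma ideal_congr (P : {pred A}) x y :
  idealr_closed P -> {subset (a : {pred A}) <= P} ->
  x - y \in (a : {pred A}) -> (x \in P) = (y \in P).
Proof.
move=> [_ _ PD] aP axy; apply/idP/idP => Pz.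
  by rewrite -(subKr x y) addrC -mulN1r; apply: PD => //; apply: aP.
by rewrite -(subrK y x) -[x - y]mul1r; apply: PD => //; apply: aP.
Qed.

Lemma prime_ideal_pi (P : {pred Q}) :
  prime_ideal P -> prime_ideal [pred x : A | \pi_Q%qT x \in P].
Proof.
move=> [[P0 P1 PD] PM]; split; first split.
- by rewrite inE rmorph0.
- by rewrite inE rmorph1.
- by move=> x y z; rewrite !inE rmorphD rmorphM; apply: PD.
by move=> x y; rewrite !inE rmorphM; apply: PM.
Qed.

(** [repr] respects sums and products only up to elements of [a]; as [P] contains [a], [ideal_congr]
    absorbs the discrepancy. *)
Lemma prime_ideal_repr (P : {pred A}) :
  {subset (a : {pred A}) <= P} ->
  prime_ideal P -> prime_ideal [pred x : Q | repr x \in P].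
Proof.
move=> aP [Pid PM]; have E := ideal_congr Pid aP; have [P0 P1 PD] := Pid.
split; first split.
- by rewrite inE -(rmorph0 \pi_Q%qT) (E _ 0) ?repr_piB.
- by rewrite inE -(rmorph1 \pi_Q%qT) (E _ 1) ?repr_piB.
- move=> x y z; rewrite !inE => hy hz.
  rewrite -[x]reprK -[y]reprK -[z]reprK -rmorphM -rmorphD (E _ _ (repr_piB _)).
  by apply: PD; rewrite ?reprK.
move=> x y; rewrite !inE -{1}[x]reprK -{1}[y]reprK -rmorphM.
by rewrite (E _ _ (repr_piB _)); apply: PM.
Qed.

Lemma has_krull_dim_quot d :
  (exists2 P : 'I_d.+1 -> {pred A}, prime_chain P &
     forall i, {subset (a : {pred A}) <= P i}) ->
  (forall e (P : 'I_e.+1 -> {pred A}), prime_chain P ->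
     (forall i, {subset (a : {pred A}) <= P i}) -> (e <= d)%N) ->
  has_krull_dim Q d.
Proof.
move=> [P [Pp Pc] aP] H; split.
  exists (fun i => [pred x : Q | repr x \in P i] : {pred Q}); split.
    by move=> i; apply: prime_ideal_repr.
  move=> i j /Pc[sub nsub]; split; first by move=> x; rewrite !inE; apply: sub.
  move=> sub'; apply: nsub => x Px.
  have E l := ideal_congr (proj1 (Pp l)) (aP l) (repr_piB x).
  by rewrite -E; apply: (sub' (\pi_Q%qT x)); rewrite inE E.
move=> e R [Rp Rc].
apply: (H e (fun i => [pred x : A | \pi_Q%qT x \in R i] : {pred A})); first split.
- by move=> i; apply: prime_ideal_pi.
- move=> i j /Rc[sub nsub]; split; first by move=> x; rewrite !inE; apply: sub.
  move=> sub'; apply: nsub => x; rewrite -[x]reprK => hx.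
  exact: (sub' (repr x)).
move=> i x /quot_pi0 hx; rewrite inE hx.
by case: (Rp i) => -[].
Qed.

End Quotient.

Section Independence.
Variables (k : fieldType) (A : comNzRingType) (iota : k -> A) (deg : A -> nat).
Hypotheses (iota0 : iota 0 = 0)
  (iotaV : forall c, c != 0 -> exists b, b * iota c = 1)
  (deg1 : deg 1 = 0%N)
  (degM : forall x y, (deg (x * y) <= deg x + deg y)%N).

Definition independent_mod (P : {pred A}) (J : finType) (y : J -> A) : Prop :=
  forall u : J -> k, \sum_j iota (u j) * y j \in P -> forall j, u j = 0.

Lemma degX x i : (deg (x ^+ i) <= i * deg x)%N.
Proof.
elim: i => [|i IH]; first by rewrite expr0 deg1.
by rewrite exprS (leq_trans (degM _ _)) // mulSn leq_add2l.
Qed.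

Lemma prime_ideal_pow (P : {pred A}) x i z :
  prime_ideal P -> x \notin P -> x ^+ i * z \in P -> z \in P.
Proof.
move=> [_ PM] xP; elim: i => [|i IH]; first by rewrite expr0 mul1r.
by rewrite exprS -mulrA => /PM; rewrite (negPf xP) => /IH.
Qed.

(* If sum_i x^i z_i lies in P and z_i is the first nonzero term, then x^i can be
   cancelled modulo P, and z_i lies in P' because x does. *)
Lemma independent_mod_step (P P' : {pred A}) x s (J : finType) (y : J -> A) :
  prime_ideal P -> prime_ideal P' -> {subset P <= P'} ->
  x \in P' -> x \notin P -> independent_mod P' y ->
  independent_mod P (fun ij : 'I_s * J => x ^+ ij.1 * y ij.2).
Proof.
move=> Pp P'p sub xP' xP ind u.
have [[P'0 _ P'D] _] := P'p.
pose z (i : 'I_s) := \sum_j iota (u (i, j)) * y j.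
have -> : \sum_j iota (u j) * (x ^+ j.1 * y j.2) = \sum_(i < s) x ^+ i * z i.
  transitivity (\sum_(i < s) \sum_j iota (u (i, j)) * (x ^+ i * y j)).
    by rewrite pair_bigA; apply: eq_bigr => -[].
  by apply: eq_bigr => i _; rewrite mulr_sumr; apply: eq_bigr => j _; rewrite mulrCA.
move=> h; suff H (i : 'I_s) : forall j, u (i, j) = 0 by case=> i j; apply: H.
have [n] := ubnP (i : nat); elim: n i => // n IH i; rewrite ltnS => ile.
have z0 (l : 'I_s) : (l < i)%N -> z l = 0.
  move=> li; apply: big1 => j _; rewrite IH ?iota0 ?mul0r //.
  exact: leq_trans li ile.
apply: ind; rewrite -/(z i).
have E : \sum_(l < s) x ^+ l * z l =
    x ^+ i * (z i + x * \sum_(l < s | (i < l)%N) x ^+ (l - i.+1) * z l).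
  rewrite (bigID (fun l : 'I_s => (l < i)%N)) /= big1 ?add0r => [|l /z0 ->];
    last by rewrite mulr0.
  rewrite (bigD1 i) ?ltnn //= mulrDr mulrA -exprSr; congr (_ + _).
  rewrite mulr_sumr; apply: eq_big => [l|l].
    by rewrite -leqNgt -(inj_eq val_inj) /= [in RHS]ltn_neqAle andbC eq_sym.
  case/andP; rewrite -leqNgt -(inj_eq val_inj) /= => h1 h2.
  by rewrite mulrA -exprD; congr (_ ^+ _ * _); lia.
move: h; rewrite E => /(prime_ideal_pow Pp xP)/sub h.
set w := \sum_(l < s | _) _ in h.
have -> : z i = - w * x + (z i + x * w) by rewrite mulNr (mulrC w) addrC addrK.
exact: P'D.
Qed.

(** Induction from the top of the chain: each step multiplies the family by the powers below [s] of
    one element of the next prime outside the current one. [D] is the sum of the degrees of these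
    elements, hence independent of [s]. *)
Lemma prime_chain_independent e (P : 'I_e.+1 -> {pred A}) :
  prime_chain P ->
  exists D, forall s, exists (J : finType) (y : J -> A),
    [/\ #|J| = (s ^ e)%N, independent_mod (P ord0) y &
        forall j, (deg (y j) <= D * s)%N].
Proof.
elim: e P => [|e IH] P [Pp Pc].
  (* The family reduced to 1 is independent because a proper ideal contains no unit. *)
  exists 0%N => s; exists unit, (fun=> 1); split; rewrite ?card_unit ?deg1 //.
  move=> u; rewrite (bigD1 tt) //= big1 ?addr0 ?mulr1 => [h []|[] //].
  apply/eqP/negP => /negP/iotaV[b hb].
  have [[P0 /negP P1 PD] _] := Pp ord0; apply: P1.
  by rewrite -hb -[_ * _]addr0; apply: PD.
have [|D HD] := IH (fun i => P (lift ord0 i)).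
  by split=> [i|i j ij]; [apply: Pp|apply: Pc].
have [sub nsub] := Pc ord0 (lift ord0 ord0) isT.
have [x xP' xP] : exists2 x, x \in P (lift ord0 ord0) & x \notin P ord0.
  have /existsNP[x /not_implyP[h /negP h']] := nsub.
  by exists x.
exists (D + deg x)%N => s; have [J [y [cJ ind dy]]] := HD s.
exists ('I_s * J)%type, (fun ij : 'I_s * J => x ^+ ij.1 * y ij.2); split.
- by rewrite card_prod card_ord cJ expnS.
- exact: (independent_mod_step (Pp _) (Pp (lift ord0 ord0))).
move=> [i j] /=; rewrite (leq_trans (degM _ _)) // mulnDl addnC leq_add //.
by rewrite (leq_trans (degX _ _)) // mulnC leq_mul2l ltnW ?orbT.
Qed.

End Independence.

(** * Monomial ideals *)

Lemma pred_ext (T : Type) (I J : {pred T}) : I =i J -> I = J.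
Proof. by move=> IJ; apply/funext => x; apply: IJ. Qed.

Lemma ideal_gen_sub (R : comNzRingType) (S S' : R -> Prop) :
  (forall g, S g -> g \in ideal_gen S') ->
  (forall g, S' g -> g \in ideal_gen S) -> ideal_gen S = ideal_gen S'.
Proof.
by move=> h h'; apply: pred_ext => f; apply/idP/idP; apply: ideal_gen_min.
Qed.

Section MonomialIdeals.
Variables (k : fieldType) (N : nat).
Local Notation R := {mpoly k[N]}.
Local Notation mon := (@monomial_ideal k N).
Implicit Types (G H : seq 'X_{1..N}) (c g h : 'X_{1..N}) (f : R).

Lemma lepm_add c d g h :
  (g <= c)%MM -> (h <= d)%MM -> (g + h <= c + d)%MM.
Proof.
move=> /mnm_lepP gc /mnm_lepP hd; apply/mnm_lepP => i.
by rewrite !mnmDE leq_add.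
Qed.

Definition multiple_of G : pred 'X_{1..N} :=
  fun c => has (fun g => (g <= c)%MM) G.

Lemma multiple_ofP G c :
  reflect (exists2 g, g \in G & (g <= c)%MM) (multiple_of G c).
Proof. exact: hasP. Qed.

(** Multiplication by a monomial translates supports, and conversely each term of [f] divisible by a
    generator lies in the ideal. Membership becomes a test on exponents. *)
Lemma mem_monomial_ideal G f :
  (f \in mon G) = all (multiple_of G) (msupp f).
Proof.
apply/idP/allP => [/asboolP[s hs ->] c|h].
  apply: contraLR => hc; rewrite -mcoeff_eq0 raddf_sum /= big_seq big1 //.
  move=> p /hs[g gG ->]; apply/eqP; rewrite mcoeff_eq0 (perm_mem (msuppMX _ _)).
  apply: contra hc => /mapP[m _ ->]; apply/multiple_ofP; exists g => //.
  exact: lem_addr.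
rewrite (mpolyE f) big_seq; apply: ideal_gen_sum => c /h /multiple_ofP[g gG gc].
rewrite -[c in 'X_[c]](submK gc) mpolyXD -mul_mpolyC mulrA.
by apply: ideal_genM; apply: ideal_gen_in; exists g.
Qed.

Lemma monomial_idealP G f :
  reflect (forall c, c \in msupp f -> exists2 g, g \in G & (g <= c)%MM)
    (f \in mon G).
Proof.
rewrite mem_monomial_ideal; apply: (iffP allP) => h c /h.
  by move/multiple_ofP.
by move=> hc; apply/multiple_ofP.
Qed.

Lemma monomial_idealX G c :
  ('X_[c] \in mon G) = multiple_of G c.
Proof. by rewrite mem_monomial_ideal msuppX /= andbT. Qed.

Lemma eq_monomial_ideal G H : G =i H -> mon G = mon H.
Proof.
move=> GH; apply: pred_ext => f; rewrite !mem_monomial_ideal.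
by apply: eq_all => c; apply: eq_has_r.
Qed.

Definition mnm_sums G H := [seq (g + h)%MM | g <- G, h <- H].

Lemma ideal_mul_monomial G H :
  ideal_mul (mon G) (mon H)
    = mon (mnm_sums G H).
Proof.
apply: ideal_gen_sub => f.
  move=> [a [b [/monomial_idealP ha /monomial_idealP hb ->]]].
  apply/monomial_idealP => c /msuppM_le /allpairsP[[c1 c2] /= [/ha h1 /hb h2 ->]].
  have [g gG g1] := h1; have [h hH h2'] := h2.
  exists (g + h)%MM; first by apply/allpairsP; exists (g, h).
  exact: lepm_add.
move=> [_ /allpairsP[[g h] /= [gG hH ->]] ->]; rewrite mpolyXD.
by apply: ideal_mul_in; rewrite monomial_idealX; apply/multiple_ofP;
   [exists g|exists h]; rewrite ?lepm_refl.
Qed.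

Definition mnm_pow G i := iter i (mnm_sums G) [:: 0%MM].

Lemma ideal_exp_monomial G i :
  ideal_exp (mon G) i = mon (mnm_pow G i).
Proof.
elim: i => [|i IH]; last by rewrite /ideal_exp iterS -/(ideal_exp _ _) IH ideal_mul_monomial.
apply: pred_ext => f; transitivity true => //.
apply/esym/monomial_idealP => c _; exists 0%MM.
  by rewrite inE.
by apply/mnm_lepP => j; rewrite mnm0E.
Qed.

Lemma max_ideal_monomial :
  @max_ideal k N = mon ([seq U_(i)%MM | i <- enum 'I_N]).
Proof.
apply: ideal_gen_sub => [f [i ->]|f [_ /mapP[i _ ->] ->]]; apply: ideal_gen_in.
  by exists U_(i)%MM => //; apply: map_f; rewrite mem_enum.
by exists i.
Qed.

(** * Ideals generated by monomials of one positive weight *)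

Section Weighted.
Variable a : 'I_N -> nat.
Hypothesis a_gt0 : forall i, (0 < a i)%N.

Definition mnm_weight c := (\sum_i a i * c i)%N.

Lemma mnm_weight0 : mnm_weight 0%MM = 0%N.
Proof. by rewrite /mnm_weight big1 // => i _; rewrite mnm0E muln0. Qed.

Lemma mnm_weightD c g : mnm_weight (c + g)%MM = (mnm_weight c + mnm_weight g)%N.
Proof.
by rewrite -big_split /=; apply: eq_bigr => i _; rewrite mnmDE mulnDr.
Qed.

Lemma mnm_weight_le g c : (g <= c)%MM -> (mnm_weight g <= mnm_weight c)%N.
Proof.
by move=> /mnm_lepP gc; apply: leq_sum => i _; rewrite leq_mul2l gc orbT.
Qed.

Lemma mnm_weight_eq0 c : (mnm_weight c == 0%N) = (c == 0%MM).
Proof.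
apply/idP/eqP => [|->]; last by rewrite mnm_weight0.
rewrite /mnm_weight sum_nat_eq0 => /forallP h; apply/mnmP => i.
by apply/eqP; move: (h i); rewrite muln_eq0 (gtn_eqF (a_gt0 i)) mnm0E.
Qed.

Lemma mnm_weight_inj g c :
  (g <= c)%MM -> (mnm_weight c <= mnm_weight g)%N -> c = g.
Proof.
move=> gc; rewrite -[c in mnm_weight c](submK gc) mnm_weightD -{2}[mnm_weight g]add0n.
rewrite leq_add2r leqn0 mnm_weight_eq0 => /eqP c0.
by rewrite -(submK gc) c0 add0m.
Qed.

Definition equigenerated G d := forall g, g \in G -> mnm_weight g = d.

Lemma equigenerated_sums G H d e :
  equigenerated G d -> equigenerated H e -> equigenerated (mnm_sums G H) (d + e).
Proof.
by move=> hG hH _ /allpairsP[[g h] /= [/hG <- /hH <- ->]]; apply: mnm_weightD.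
Qed.

Lemma equigenerated_pow G d i :
  equigenerated G d -> equigenerated (mnm_pow G i) (i * d).
Proof.
move=> hG; elim: i => [|i IH].
  by move=> g; rewrite inE => /eqP->; apply: mnm_weight0.
by rewrite mulSn; apply: equigenerated_sums.
Qed.

Lemma equigenerated_ge G d c :
  equigenerated G d -> multiple_of G c -> (d <= mnm_weight c)%N.
Proof. by move=> hG /multiple_ofP[g /hG <-]; apply: mnm_weight_le. Qed.

Lemma equigenerated_mem G d c :
  equigenerated G d -> multiple_of G c -> (mnm_weight c <= d)%N -> c \in G.
Proof.
move=> hG /multiple_ofP[g gG gc] cd.
by rewrite -(hG g gG) in cd; rewrite (mnm_weight_inj gc cd).
Qed.

(** A multiple of a generator has weight [d] only if it is that generator; otherwise a variable can
    be split off. So the monomials in [G] form a basis of the ideal modulo its product with the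
    maximal ideal. *)
Lemma mem_max_ideal_mul G d f :
  equigenerated G d ->
  (f \in ideal_mul (@max_ideal k N) (mon G)) =
  (f \in mon G) && all (fun c => mnm_weight c != d) (msupp f).
Proof.
move=> hG; rewrite max_ideal_monomial ideal_mul_monomial !mem_monomial_ideal.
rewrite -all_predI; apply: eq_all => c /=.
apply/multiple_ofP/andP => [[_ /allpairsP[[u g] /= [/mapP[i _ ->] gG ->]] uc]|].
  have gc : (g <= c)%MM by apply: lepm_trans uc; apply: lem_addl.
  split; first by apply/multiple_ofP; exists g.
  rewrite gtn_eqF // -(hG _ gG); apply: leq_trans (mnm_weight_le uc).
  by rewrite mnm_weightD -addn1 addnC leq_add2r lt0n mnm_weight_eq0 mnm1_eq0.
move=> [/multiple_ofP[g gG gc] cd].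
have : (c - g != 0)%MM.
  by apply: contra cd => /eqP c0; rewrite -(submK gc) c0 add0m hG.
rewrite -mdeg_eq0 mdegE sum_nat_eq0 negb_forall => /existsP[i /= hi].
exists (U_(i) + g)%MM.
  by apply/allpairsP; exists (U_(i)%MM, g); split=> //; apply: map_f; rewrite mem_enum.
rewrite -(submK gc); apply: lepm_add (lepm_refl g); apply/mnm_lepP => j.
by rewrite mnm1E; case: eqP => // <-; rewrite lt0n.
Qed.

(** All terms of [f] have weight at least [d], so only the constant term of [q] contributes in
    weight [d]. *)
Lemma mcoeffM_equigenerated G d (q f : R) c :
  equigenerated G d -> f \in mon G -> mnm_weight c = d ->
  (q * f)@_c = q@_0%MM * f@_c.
Proof.
move=> hG; rewrite mem_monomial_ideal => /allP hf cd.
rewrite -mcoeffCM -{1}(subrK (q@_0%MM)%:MP q) mulrDl mcoeffD.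
suff /eqP-> : (((q - (q@_0%MM)%:MP) * f)@_c == 0) by rewrite add0r.
rewrite mcoeff_eq0; apply/negP => /msuppM_le/allpairsP[[u v] /= [hu hv cE]].
have dv := equigenerated_ge hG (hf _ hv).
have u0 : u = 0%MM.
  by apply/eqP; rewrite -mnm_weight_eq0; move: cd; rewrite cE mnm_weightD; lia.
by move: hu; rewrite u0 mcoeff_msupp mcoeffB mcoeffC eqxx mulr1 subrr eqxx.
Qed.

(** Minimality is a rank bound: expressing each generator through a generating list [s] puts the
    identity in the row space of the matrix [M] of coefficients of [s] at [G]. *)
Lemma has_min_gens_monomial G d :
  uniq G -> equigenerated G d -> has_min_gens (mon G) (size G).
Proof.
move=> uG hG; split.
  exists [seq 'X_[g] | g <- G]; first by rewrite size_map.
  suff -> : mon G = ideal_gen (fun f => f \in [seq 'X_[g] | g <- G]) by [].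
  apply: ideal_gen_sub => f.
    by move=> [g gG ->]; apply: ideal_gen_in; apply: map_f.
  by move=> /mapP[g gG ->]; apply: ideal_gen_in; exists g.
move=> s hs; pose M := \matrix_(i < size s, j < size G) (s`_i)@_(nth 0%MM G j).
suff h : (1%:M <= M)%MS.
  by rewrite -(mxrank1 k (size G)) (leq_trans (mxrankS h)) // rank_leq_row.
apply/row_subP => j.
have : 'X_[nth 0%MM G j] \in ideal_gen (fun f => f \in s).
  rewrite -hs monomial_idealX; apply/multiple_ofP.
  by exists (nth 0%MM G j); [apply: mem_nth|apply: lepm_refl].
move=> /asboolP[t ht tE].
have -> : row j 1%:M = \sum_(p <- t) p.1@_0%MM *: \row_l p.2@_(nth 0%MM G l).
  apply/rowP => l; rewrite summxE 2!mxE.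
  transitivity (('X_[nth 0%MM G j] : R)@_(nth 0%MM G l)).
    by rewrite mcoeffX nth_uniq // eq_sym.
  rewrite tE raddf_sum /= !big_seq; apply: eq_bigr => p /ht ps; rewrite !mxE.
  apply: (mcoeffM_equigenerated _ hG); last by apply: hG; apply: mem_nth.
  by rewrite hs; apply: ideal_gen_in.
rewrite big_seq; apply: summx_sub => p /ht ps; apply: scalemx_sub.
have ip : (index p.2 s < size s)%N by rewrite index_mem.
suff -> : \row_l p.2@_(nth 0%MM G l) = row (Ordinal ip) M by apply: row_sub.
by apply/rowP => l; rewrite !mxE nth_index.
Qed.

Lemma quasi_equigenerated_monomial G d :
  equigenerated G d -> quasi_equigenerated (mon G).
Proof.
move=> hG; exists G.
  split=> // G' G'G E c cG.
  have : 'X_[c] \in mon G'.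
    rewrite -E monomial_idealX; apply/multiple_ofP; exists c => //.
    exact: lepm_refl.
  rewrite monomial_idealX => h; apply: (@equigenerated_mem G' d c) => //.
    by move=> g /G'G /hG.
  by rewrite hG.
by exists a => // c c' /hG + /hG; rewrite /mnm_weight => -> ->.
Qed.

End Weighted.
End MonomialIdeals.

(** * The Rees algebra of an equigenerated monomial ideal *)

Lemma if_sum (V : nmodType) (J : finType) (P : pred J) (b : bool) (F : J -> V) :
  (if b then \sum_(j | P j) F j else 0) = \sum_(j | P j) if b then F j else 0.
Proof. by case: b => //; rewrite big1. Qed.

Section Rees.
Variables (k : fieldType) (N : nat) (a : 'I_N -> nat).
Hypothesis a_gt0 : forall i, (0 < a i)%N.
Variables (G : seq 'X_{1..N}) (d : nat).
Hypothesis hG : equigenerated a G d.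
Local Notation R := {mpoly k[N]}.
Local Notation I := (@monomial_ideal k N G).
Local Notation wt := (mnm_weight a).
Implicit Types (x y : rees I) (p q : {poly R}) (c : 'X_{1..N}).

Lemma rees_val_coef x i : (rees_val x)`_i \in @monomial_ideal k N (mnm_pow G i).
Proof. by case: x => p /= /asboolP/(_ i); rewrite ideal_exp_monomial. Qed.

Lemma rees_val_multiple x i c :
  ((rees_val x)`_i)@_c != 0 -> multiple_of (mnm_pow G i) c.
Proof.
rewrite -mcoeff_msupp; move: (rees_val_coef x i).
by rewrite mem_monomial_ideal => /allP; apply.
Qed.

Lemma rees_maxP x :
  reflect (forall i c, wt c = (i * d)%N -> ((rees_val x)`_i)@_c = 0)
    (x \in @rees_max_pred k N I).
Proof.
apply: (iffP idP) => [/asboolP h i c wc|h]; last (apply/asboolP => i).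
  move: (h i); rewrite ideal_exp_monomial.
  rewrite (mem_max_ideal_mul a_gt0 _ (equigenerated_pow hG)) => /andP[_ /allP hc].
  apply/eqP; apply: contraT; rewrite -mcoeff_msupp => /hc.
  by rewrite wc eqxx.
rewrite ideal_exp_monomial (mem_max_ideal_mul a_gt0 _ (equigenerated_pow hG)).
rewrite rees_val_coef; apply/allP => c; rewrite mcoeff_msupp.
by apply: contra => /eqP/h ->.
Qed.

Lemma rees_valD x y : rees_val (x + y) = rees_val x + rees_val y.
Proof. exact: (raddfD val). Qed.

Lemma rees_valM x y : rees_val (x * y) = rees_val x * rees_val y.
Proof. exact: (rmorphM val). Qed.

Lemma rees_val1 : rees_val (1 : rees I) = 1.
Proof. exact: (rmorph1 val). Qed.

Lemma rees_val0 : rees_val (0 : rees I) = 0.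
Proof. exact: (raddf0 val). Qed.

Lemma rees_val_sum (J : finType) (F : J -> rees I) :
  rees_val (\sum_j F j) = \sum_j rees_val (F j).
Proof. exact: (raddf_sum val). Qed.

(* The monomials c t^i with [Phi i c] are those on a face of the exponent cone
   of the fiber cone. *)
Definition is_face (Phi : nat -> pred 'X_{1..N}) : Prop :=
  [/\ Phi 0%N 0%MM,
      forall i c, Phi i c -> wt c = (i * d)%N &
      forall i j c e, multiple_of (mnm_pow G i) c -> multiple_of (mnm_pow G j) e ->
        Phi (i + j)%N (c + e)%MM = Phi i c && Phi j e].

(** * Prime ideals attached to faces of the exponent cone *)

Section Face.
Variable Phi : nat -> pred 'X_{1..N}.
Hypothesis hPhi : is_face Phi.

(* On the Rees algebra, discarding the terms off the face is a ring morphism to a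
   domain; its kernel is the prime ideal of the face. *)
Definition face_part p : {poly R} :=
  \poly_(i < size p) \sum_(c <- msupp p`_i | Phi i c) (p`_i)@_c *: 'X_[c].

Lemma mcoeff_face_part p i c :
  ((face_part p)`_i)@_c = if Phi i c then (p`_i)@_c else 0.
Proof.
rewrite coef_poly; case: ltnP => [_|h]; last first.
  by rewrite [p`_i]nth_default // mcoeff0 if_same.
rewrite raddf_sum /=; case: ifPn => Pc.
  rewrite [in RHS](mpolyE p`_i) raddf_sum /= big_mkcond /=.
  apply: eq_bigr => e _; rewrite mcoeffZ mcoeffX; case: ifPn => // /negPf Pe.
  by case: eqP => [E|]; [rewrite E Pc in Pe|rewrite mulr0].
apply: big1 => e Pe; rewrite mcoeffZ mcoeffX; case: eqP => [E|]; last by rewrite mulr0.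
by rewrite -E Pe in Pc.
Qed.

Lemma face_partD p q : face_part (p + q) = face_part p + face_part q.
Proof.
apply/polyP => i; apply/mpolyP => c.
by rewrite coefD mcoeffD !mcoeff_face_part coefD mcoeffD; case: ifP; rewrite ?addr0.
Qed.

Lemma face_partM x y :
  face_part (rees_val x * rees_val y) =
  face_part (rees_val x) * face_part (rees_val y).
Proof.
have [_ _ PhiD] := hPhi.
apply/polyP => i; apply/mpolyP => c; rewrite mcoeff_face_part !coefM.
rewrite !raddf_sum /= if_sum; apply: eq_bigr => j _; rewrite !mcoeffM if_sum.
apply: eq_bigr => e /eqP cE; rewrite !mcoeff_face_part.
(* [PhiD] is available only for exponents in the powers of the ideal, so zero coefficients are set
   aside first. *)
have [->|x0] := eqVneq ((rees_val x)`_j)@_e.1 0.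
  by rewrite !mul0r !if_same mul0r.
have [->|y0] := eqVneq ((rees_val y)`_(i - j))@_e.2 0.
  by rewrite !mulr0 !if_same mulr0.
have := PhiD _ _ _ _ (rees_val_multiple x0) (rees_val_multiple y0).
rewrite -cE subnKC ?leq_ord // => ->.
by case: (Phi j _); case: (Phi (i - j)%N _); rewrite ?mulr0 ?mul0r.
Qed.

Definition face_ideal : {pred rees I} :=
  [pred x : rees I | face_part (rees_val x) == 0].

Lemma face_idealP x :
  reflect (forall i c, Phi i c -> ((rees_val x)`_i)@_c = 0) (x \in face_ideal).
Proof.
apply: (iffP eqP) => [h i c Pc|h].
  by have := mcoeff_face_part (rees_val x) i c; rewrite h coef0 mcoeff0 Pc.
apply/polyP => i; apply/mpolyP => c; rewrite mcoeff_face_part coef0 mcoeff0.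
by case: ifP => // /h.
Qed.

Lemma face_ideal_prime : prime_ideal face_ideal.
Proof.
split; first split.
- by apply/face_idealP => i c _; rewrite rees_val0 coef0 mcoeff0.
- apply/negP => /face_idealP/(_ 0%N 0%MM).
  have [-> _ _] := hPhi => /(_ isT)/eqP.
  by rewrite rees_val1 coef1 mcoeff1 eqxx oner_eq0.
- move=> x y z; rewrite !inE rees_valD rees_valM face_partD face_partM.
  by move=> /eqP-> /eqP->; rewrite mulr0 addr0.
by move=> x y; rewrite !inE rees_valM face_partM mulf_eq0.
Qed.

Lemma rees_max_face : {subset @rees_max_pred k N I <= face_ideal}.
Proof.
have [_ Pw _] := hPhi.
by move=> x /rees_maxP hx; apply/face_idealP => i c /Pw/hx.
Qed.

End Face.

Lemma face_ideal_sub (Phi Psi : nat -> pred 'X_{1..N}) :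
  (forall i c, Psi i c -> Phi i c) -> {subset face_ideal Phi <= face_ideal Psi}.
Proof.
by move=> h x /face_idealP hx; apply/face_idealP => i c /h; apply: hx.
Qed.

(** The element ['X_[g]] t separates the two ideals: its single term lies on the face [Phi] and off
    [Psi]. *)
Lemma face_ideal_proper (Phi Psi : nat -> pred 'X_{1..N}) g :
  g \in G -> Phi 1%N g -> ~~ Psi 1%N g ->
  ~ {subset face_ideal Psi <= face_ideal Phi}.
Proof.
move=> gG Pg Qg sub.
have gr : (('X_[g] : R)%:P * 'X) \in rees_pred I.
  apply/asboolP => i; rewrite coefMX; case: i => [|i] /=; first done.
  rewrite coefC; case: eqP => [->|_]; last exact: ideal_gen0.
  rewrite -[X in X \in _]mulr1; apply: ideal_mul_in => //.
  by rewrite monomial_idealX; apply/multiple_ofP; exists g; rewrite ?lepm_refl.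
have /sub/face_idealP/(_ _ _ Pg)/eqP : Rees gr \in face_ideal Psi.
  apply/face_idealP => i c Qc /=; rewrite coefMX; case: i Qc => [|i] Qc /=.
    by rewrite mcoeff0.
  rewrite coefC; case: eqP Qc => [->|_] Qc; last by rewrite mcoeff0.
  by rewrite mcoeffX; case: eqP => // gc; rewrite gc Qc in Qg.
by rewrite /= coefMX coefC /= mcoeffX eqxx oner_eq0.
Qed.

(** * Bounding chains of primes by counting exponents *)

Lemma rees_const_in (b : k) : (b%:MP : R)%:P \in rees_pred I.
Proof.
by apply/asboolP => i; rewrite coefC; case: i => [|i] //=; apply: ideal_gen0.
Qed.

Definition rees_const b : rees I := Rees (rees_const_in b).

Definition rees_deg x := (size (rees_val x)).-1.

Lemma rees_const0 : rees_const 0 = 0.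
Proof. by apply: val_inj; rewrite [RHS]rees_val0 /= mpolyC0. Qed.

Lemma rees_constV b : b != 0 -> exists b', b' * rees_const b = 1.
Proof.
move=> b0; exists (rees_const b^-1); apply: val_inj.
by rewrite [LHS]rees_valM [RHS]rees_val1 /= -polyCM -mpolyCM mulVf.
Qed.

Lemma rees_deg1 : rees_deg 1 = 0%N.
Proof. by rewrite /rees_deg rees_val1 size_poly1. Qed.

Lemma rees_degM x y : (rees_deg (x * y)%R <= rees_deg x + rees_deg y)%N.
Proof.
rewrite /rees_deg rees_valM; have /= := size_polyMleq (rees_val x) (rees_val y); lia.
Qed.

Definition graded_exponents t :=
  undup [seq (i, c) | i <- iota 0 t.+1, c <- mnm_pow G i].

(* Modulo the maximal ideal, an element of degree at most t is determined by its
   coefficients at [graded_exponents t]. *)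
Lemma independent_mod_card (P : {pred rees I}) (J : finType) (y : J -> rees I) t :
  {subset @rees_max_pred k N I <= P} -> independent_mod rees_const P y ->
  (forall j, rees_deg (y j) <= t)%N -> (#|J| <= size (graded_exponents t))%N.
Proof.
move=> sub ind dy; rewrite leqNgt; apply/negP => lt.
set L := graded_exponents t in lt.
pose M := \matrix_(j < #|J|, l < size L)
   (let ic := nth (0%N, 0%MM) L l in ((rees_val (y (enum_val j)))`_ic.1)@_ic.2).
(* There are more rows than columns, so some nontrivial combination of the [y j] has all its
   coefficients at [L] equal to zero. *)
have : kermx M != 0.
  rewrite -mxrank_eq0 mxrank_ker subn_eq0 -ltnNge.
  exact: leq_ltn_trans (rank_leq_col M) lt.
case/rowV0Pn => u /sub_kermxP uM u0.
case/negP: u0; apply/eqP/rowP => j; rewrite mxE.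
have := ind (fun j => u 0 (enum_rank j)) _ (enum_val j); rewrite enum_valK; apply.
apply: sub; apply/rees_maxP => i c wc.
transitivity (\sum_j u 0 (enum_rank j) * ((rees_val (y j))`_i)@_c).
  rewrite rees_val_sum coef_sum raddf_sum; apply: eq_bigr => l _.
  by rewrite rees_valM coefCM [LHS]mcoeffCM.
have [icL|icL] := boolP ((i, c) \in L).
  have ip : (index (i, c) L < size L)%N by rewrite index_mem.
  have /rowP/(_ (Ordinal ip)) := uM; rewrite !mxE => E; rewrite -[RHS]E.
  rewrite (reindex (@enum_val _ J)) /=; last first.
    by exists enum_rank => z _; rewrite ?enum_valK ?enum_rankK.
  by apply: eq_bigr => l _; rewrite enum_valK mxE nth_index.
(* A nonzero coefficient in weight [i * d] would make [c] the exponent of a product of [i <= t]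
   generators, and the pair would belong to [L]. *)
apply: big1 => l _; apply/eqP; rewrite mulf_eq0; apply/orP; right.
apply: contraR icL => yc; rewrite mem_undup.
apply/allpairsPdep; exists i, c; split=> //.
  rewrite mem_iota /= add0n ltnS.
  apply: leq_trans (dy l); rewrite /rees_deg.
  have : (i < size (rees_val (y l)))%N; last by lia.
  by rewrite ltnNge; apply: contra yc => h; rewrite nth_default ?mcoeff0.
apply: (equigenerated_mem a_gt0 (equigenerated_pow hG) (rees_val_multiple yc)).
by rewrite wc.
Qed.

Lemma prime_chain_rees_bound l e (P : 'I_e.+1 -> {pred rees I}) :
  (forall t, (size (graded_exponents t) <= t.+1 ^ l)%N) ->
  prime_chain P -> (forall i, {subset @rees_max_pred k N I <= P i}) -> (e <= l)%N.
Proof.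
move=> hL Pc sub.
have [D HD] :=
  prime_chain_independent rees_const0 rees_constV rees_deg1 rees_degM Pc.
rewrite leqNgt; apply/negP => lt.
(* The count is at most [(D * s).+1 ^ l], hence at most [(D.+1 * s) ^ l], which is below [s ^ l.+1]
   once [s] exceeds [D.+1 ^ l]. *)
pose s := (D.+1 ^ l).+1; have [J [y [cJ ind dy]]] := HD s.
have := leq_trans (independent_mod_card (sub ord0) ind dy) (hL _).
rewrite cJ leqNgt => /negP; apply.
apply: (@leq_ltn_trans ((D.+1 * s) ^ l)); last first.
  rewrite expnMn (@leq_trans (s ^ l.+1)) ?leq_pexp2l //.
  by rewrite expnS ltn_pmul2r ?expn_gt0.
by case: (l) => // l'; rewrite leq_exp2r // mulSn addnC -addn1 leq_add2l.
Qed.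

(** The faces shrink as [s] grows, so their prime ideals increase, strictly because of the
    generators [g]; the count of exponents gives the upper bound. *)
Lemma has_analytic_spread_faces l (Phi : nat -> nat -> pred 'X_{1..N}) :
  (forall s, is_face (Phi s)) ->
  (forall s s' i c, (s <= s')%N -> Phi s' i c -> Phi s i c) ->
  (forall s, (s < l)%N ->
     exists g, [/\ g \in G, Phi s 1%N g & ~~ Phi s.+1 1%N g]) ->
  (forall t, (size (graded_exponents t) <= t.+1 ^ l)%N) ->
  has_analytic_spread I l.
Proof.
move=> hPhi Phi_sub Phi_proper hL; apply: has_krull_dim_quot; last first.
  by move=> e P; apply: prime_chain_rees_bound.
exists (fun s : 'I_l.+1 => face_ideal (Phi s)); last first.
  by move=> s; apply: rees_max_face.
split=> [s|s s' ss']; first exact: face_ideal_prime.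
split; first by apply: face_ideal_sub => i c; apply: Phi_sub; apply: ltnW.
have [g [gG Pg Qg]] := Phi_proper s (leq_trans ss' (leq_ord s')).
move=> sub; apply: (face_ideal_proper gG Pg Qg) => x hx; apply: sub.
by apply: (face_ideal_sub _ hx) => i c; apply: Phi_sub.
Qed.

(** * Coordinate faces for squarefree generators *)

Definition squarefree := forall g v, g \in G -> (g v <= 1)%N.

Lemma squarefree_pow i c v : squarefree -> c \in mnm_pow G i -> (c v <= i)%N.
Proof.
move=> sqf; elim: i c => [|i IH] c.
  by rewrite inE => /eqP->; rewrite mnm0E.
move=> /allpairsP[[g h] /= [gG /IH hh ->]]; rewrite mnmDE -addn1 addnC.
by apply: leq_add => //; apply: sqf.
Qed.

(** A product of [i] squarefree generators satisfies [c v <= i]; the coordinates in [Z] are required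
    to attain this bound. *)
Definition coord_face (Z : pred 'I_N) i c :=
  (wt c == i * d)%N && [forall v, Z v ==> (c v == i)].

(** Both conditions are equality cases of additive inequalities, [i * d <= wt c] and then
    [c v <= i], so a sum satisfies them exactly when both summands do. *)
Lemma coord_faceP (Z : pred 'I_N) : squarefree -> is_face (coord_face Z).
Proof.
move=> sqf; split.
- rewrite /coord_face mnm_weight0 eqxx; apply/forallP => v.
  by rewrite mnm0E eqxx implybT.
- by move=> i c /andP[/eqP].
move=> i j c e ci ej.
have wc := equigenerated_ge (equigenerated_pow hG) ci.
have we := equigenerated_ge (equigenerated_pow hG) ej.
rewrite /coord_face mnm_weightD mulnDl.
have [cE|] := eqVneq (wt c) (i * d)%N; last by move=> ne /=; apply/negbTE; lia.
have [eE|] := eqVneq (wt e) (j * d)%N; last by rewrite andbF; move=> ne /=; apply/negbTE; lia.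
rewrite cE eE eqxx /=.
have ci' : c \in mnm_pow G i.
  by apply: (equigenerated_mem a_gt0 (equigenerated_pow hG)) => //; rewrite cE.
have ej' : e \in mnm_pow G j.
  by apply: (equigenerated_mem a_gt0 (equigenerated_pow hG)) => //; rewrite eE.
apply/forallP/andP => [h|[/forallP hc /forallP he] v]; last first.
  by apply/implyP => Zv; rewrite mnmDE (eqP (implyP (hc v) Zv)) (eqP (implyP (he v) Zv)).
split; apply/forallP => v; apply/implyP => /(implyP (h v)); rewrite mnmDE;
  have := squarefree_pow v sqf ci'; have := squarefree_pow v sqf ej'; lia.
Qed.

End Rees.

(** * The cover ideal of two cliques sharing a vertex *)

Section TwoCliques.
Variables p q : nat.
Hypotheses (p_gt0 : (0 < p)%N) (q_gt0 : (0 < q)%N).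
Local Notation N := (p.+1 + q)%N.
Implicit Types (c g h : 'X_{1..N}) (u v : 'I_N).

(** With the vertices numbered from 0 to [p + q], the cliques are the intervals [0, p] and
    [p, p + q], meeting in the hub [p]. *)
Lemma AgraphE u v :
  Agraph p.+1 q.+1 u v =
  (u != v) && ((u <= p) && (v <= p) || (p <= u) && (p <= v))%N.
Proof.
rewrite /Agraph -(inj_eq val_inj u v) /=.
case: (splitP u) => [i ->|i ->]; case: (splitP v) => [j ->|j ->];
  rewrite -?(inj_eq val_inj) /=; try lia.
all: have := ltn_ord i; have := ltn_ord j; lia.
Qed.

(* The maximal independent sets are {p} and {i, p + 1 + j} with i < p, j < q;
   these are the indicators of their complements. *)
Definition hub_cover : 'X_{1..N} := [multinom (v != p :> nat : nat) | v < N].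
Definition pair_cover (i j : nat) : 'X_{1..N} :=
  [multinom ((v != i :> nat) && (v != p.+1 + j :> nat)%N : nat) | v < N].
Definition covers := hub_cover :: [seq pair_cover i j | i <- iota 0 p, j <- iota 0 q].

Lemma hub_coverE v : hub_cover v = (v != p :> nat).
Proof. by rewrite mnmE. Qed.

Lemma pair_coverE i j v :
  pair_cover i j v = ((v != i :> nat) && (v != p.+1 + j :> nat)%N).
Proof. by rewrite mnmE. Qed.

Lemma coversP g :
  reflect (g = hub_cover \/ exists i j, [/\ (i < p)%N, (j < q)%N & g = pair_cover i j])
    (g \in covers).
Proof.
rewrite inE; apply: (iffP orP) => -[].
- by move/eqP; left.
- case/allpairsP => [[i j] /= []]; rewrite !mem_iota => hi hj ->.
  by right; exists i, j; split=> //; lia.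
- by move->; left.
move=> [i [j [hi hj ->]]]; right; apply/allpairsP; exists (i, j).
by rewrite !mem_iota.
Qed.

Lemma covers_squarefree : squarefree covers.
Proof.
move=> g v /coversP[->|[i [j [_ _ ->]]]]; rewrite ?hub_coverE ?pair_coverE;
  exact: leq_b1.
Qed.

(** The edge condition says that the zero set of [c] is independent: either it is the hub alone, or
    it avoids the hub and has at most one vertex on each side. The cover omitting a maximal
    independent set around it then divides. *)
Lemma multiple_of_coversP c :
  multiple_of covers c <->
  forall u v, Agraph p.+1 q.+1 u v -> (0 < c u)%N || (0 < c v)%N.
Proof.
split=> [/multiple_ofP[g /coversP gG /mnm_lepP gc] u v|h].
  rewrite AgraphE -(inj_eq val_inj) /= => uv.
  apply: contraLR uv; rewrite negb_or -!leqNgt => /andP[cu cv].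
  move: (leq_trans (gc u) cu) (leq_trans (gc v) cv).
  have := ltn_ord u; have := ltn_ord v.
  case: gG => [->|[i [j [hi hj ->]]]]; rewrite ?hub_coverE ?pair_coverE; lia.
have adj u v : c u = 0%N -> c v = 0%N -> u <> v :> nat ->
    ~~ ((u <= p) && (v <= p) || (p <= u) && (p <= v))%N.
  move=> cu cv uv; apply/negP => e; have := h u v.
  by rewrite AgraphE -(inj_eq val_inj) e cu cv (introN eqP uv) => /(_ isT).
have wp : (p < N)%N by lia.
have [cw|cw] := posnP (c (Ordinal wp)).
  apply/multiple_ofP; exists hub_cover; first by apply/coversP; left.
  apply/mnm_lepP => v; rewrite hub_coverE.
  have [cv|] := posnP (c v); last by lia.
  by have := adj _ _ cw cv => /=; lia.
have [i [hi ci]] : exists i, (i < p)%N /\ forall v, (v <= p)%N -> c v = 0%N -> v = i :> nat.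
  have [/existsP[i /andP[hi /eqP ci]]|no] := boolP [exists i : 'I_N, (i <= p)%N && (c i == 0%N)].
    exists i; split.
      rewrite ltn_neqAle hi andbT; apply/eqP => ip; move: cw.
      by rewrite (_ : Ordinal wp = i) ?ci //; apply: val_inj.
    by move=> v hv cv; have := adj _ _ cv ci; lia.
  (* With no zero on this side any index below [p] would do. *)
  exists 0%N; split=> // v hv cv; case/negP: no.
  by apply/existsP; exists v; rewrite hv cv.
have [j [hj cj]] : exists j, (j < q)%N /\
    forall v, (p <= v)%N -> c v = 0%N -> v = (p.+1 + j)%N :> nat.
  have [/existsP[j /andP[hj /eqP cj]]|no] := boolP [exists j : 'I_N, (p <= j)%N && (c j == 0%N)].
    have jp : j <> p :> nat.
      move=> jp; move: cw; rewrite (_ : Ordinal wp = j) ?cj //; exact: val_inj.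
    exists (j - p.+1)%N; split; first by have := ltn_ord j; lia.
    by move=> v hv cv; have := adj _ _ cv cj; lia.
  exists 0%N; split=> // v hv cv; case/negP: no.
  by apply/existsP; exists v; rewrite hv cv.
apply/multiple_ofP; exists (pair_cover i j); first by apply/coversP; right; exists i, j.
apply/mnm_lepP => v; rewrite pair_coverE.
have [cv|] := posnP (c v); last by lia.
have [vp|vp] := leqP v p; first by rewrite (ci v) ?eqxx.
by rewrite (cj v) ?eqxx ?andbF // ltnW.
Qed.

Lemma cover_ideal_covers (k : fieldType) :
  cover_ideal k (Agraph p.+1 q.+1) = monomial_ideal covers :> {pred {mpoly k[N]}}.
Proof.
have pairE u v : ideal_gen (fun g : {mpoly k[N]} => g = 'X_u \/ g = 'X_v) =
    monomial_ideal [:: U_(u)%MM; U_(v)%MM].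
  apply: ideal_gen_sub => g.
    by case=> ->; apply: ideal_gen_in; [exists U_(u)%MM|exists U_(v)%MM]; rewrite ?inE ?eqxx ?orbT.
  move=> [c cuv ->]; apply: ideal_gen_in; move: cuv; rewrite !inE.
  by case/orP => /eqP->; [left|right].
have pair_multiple u v c : multiple_of [:: U_(u); U_(v)]%MM c = (0 < c u)%N || (0 < c v)%N.
  rewrite /multiple_of /= orbF.
  have U x : (U_(x) <= c)%MM = (0 < c x)%N.
    apply/mnm_lepP/idP => [/(_ x)|cx y]; first by rewrite mnm1E eqxx.
    by rewrite mnm1E; case: eqP => // <-.
  by rewrite !U.
apply: pred_ext => f; rewrite mem_monomial_ideal; apply/forallP/allP => h.
  move=> c cf; apply/multiple_of_coversP => u v uv.
  have /forallP/(_ v) := h u; rewrite uv pairE mem_monomial_ideal /= => /allP/(_ c cf).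
  by rewrite pair_multiple.
move=> u; apply/forallP => v; apply/implyP => uv.
rewrite pairE mem_monomial_ideal; apply/allP => c /h /multiple_of_coversP/(_ _ _ uv).
by rewrite pair_multiple.
Qed.

(** * Weights of the covers and the analytic spread *)

Definition left_weight v : nat := (v <= p)%N.
Definition right_weight v : nat := (p <= v)%N.
(** The hub, counted in both cliques, gets weight 2. Each summand vanishes on one side but is by
    itself constant on the covers, which gives two linear relations among exponents. *)
Definition clique_weight v : nat := (left_weight v + right_weight v)%N.

Lemma clique_weight_gt0 v : (0 < clique_weight v)%N.
Proof.
by rewrite /clique_weight /left_weight /right_weight; case: (leqP v p) => // /ltnW ->.
Qed.

Lemma mnm_weight1 (a : 'I_N -> nat) v : mnm_weight a U_(v)%MM = a v.
Proof.
rewrite /mnm_weight (bigD1 v) //= mnm1E eqxx muln1 big1 ?addn0 // => u uv.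
by rewrite mnm1E eq_sym (negPf uv) muln0.
Qed.

(* Each generator becomes the all-ones exponent after adding the variables of
   the independent set it omits. *)
Lemma equigenerated_covers (a : 'I_N -> nat) d (s : nat) :
  (\sum_v a v = s)%N ->
  (forall w : 'I_N, w = p :> nat -> (d + a w = s)%N) ->
  (forall u v : 'I_N, (u < p)%N -> (p < v)%N -> (d + a u + a v = s)%N) ->
  equigenerated a covers d.
Proof.
move=> as_ hw huv g.
have one : mnm_weight a [multinom 1%N | v < N] = s.
  by rewrite -as_; apply: eq_bigr => v _; rewrite mnmE muln1.
case/coversP => [->|[i [j [hi hj ->]]]].
  have wp : (p < N)%N by lia.
  have := hw (Ordinal wp) erefl; rewrite -one -(mnm_weight1 a (Ordinal wp)).
  have -> : [multinom 1%N | v < N] = (hub_cover + U_(Ordinal wp))%MM.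
    by apply/mnmP => v; rewrite mnmDE !mnmE -(inj_eq val_inj) /= eq_sym; case: eqP.
  by rewrite mnm_weightD => /addIn.
have ip : (i < N)%N by lia.
have jp : (p.+1 + j < N)%N by lia.
have := huv (Ordinal ip) (Ordinal jp) hi (leq_addr _ _).
rewrite -one -(mnm_weight1 a (Ordinal ip)) -(mnm_weight1 a (Ordinal jp)).
have -> : [multinom 1%N | v < N] =
    (pair_cover i j + U_(Ordinal ip) + U_(Ordinal jp))%MM.
  apply/mnmP => v; rewrite !mnmDE !mnmE -!(inj_eq val_inj) /=.
  by case: eqP => ?; case: eqP => ?; case: eqP => ?; case: eqP => ?; lia.
by rewrite !mnm_weightD => /addIn/addIn.
Qed.

Lemma sum_left_weight : (\sum_v left_weight v = p.+1)%N.
Proof.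
rewrite big_split_ord /= (eq_bigr (fun=> 1%N)) => [|i _]; last first.
  by rewrite /left_weight /= -ltnS ltn_ord.
rewrite sum1_card card_ord big1 ?addn0 // => j _.
by rewrite /left_weight /=; lia.
Qed.

Lemma sum_right_weight : (\sum_v right_weight v = q.+1)%N.
Proof.
rewrite big_split_ord /= big_ord_recr /= big1 => [|i _]; last first.
  by rewrite /right_weight /=; have := ltn_ord i; lia.
rewrite (eq_bigr (fun=> 1%N)) => [|j _]; last by rewrite /right_weight /=; lia.
by rewrite sum1_card card_ord /right_weight /= leqnn.
Qed.

Lemma covers_left : equigenerated left_weight covers p.
Proof.
apply: equigenerated_covers sum_left_weight _ _; rewrite /left_weight.
  by move=> w; lia.
by move=> u v; lia.
Qed.

Lemma covers_right : equigenerated right_weight covers q.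
Proof.
apply: equigenerated_covers sum_right_weight _ _; rewrite /right_weight.
  by move=> w; lia.
by move=> u v; lia.
Qed.

Lemma covers_clique : equigenerated clique_weight covers (p + q).
Proof.
move=> g gG; transitivity (mnm_weight left_weight g + mnm_weight right_weight g)%N.
  by rewrite -big_split; apply: eq_bigr => v _; rewrite mulnDl.
by rewrite covers_left // covers_right.
Qed.

(** Products of [i <= t] covers have exponents at most [t]. Those at the first [p + q] vertices
    determine [i], through the left weight [i * p], and then the last exponent, through the right
    weight [i * q]. *)
Lemma size_graded_exponents t :
  (size (graded_exponents covers t) <= t.+1 ^ (p + q))%N.
Proof.
pose w (v : 'I_(p + q)) : 'I_N := cast_ord (esym (addSn p q)) (widen_ord (leqnSn _) v).
pose r (ic : nat * 'X_{1..N}) : {ffun 'I_(p + q) -> 'I_t.+1} :=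
  [ffun v => inord (ic.2 (w v))].
have last_ord : (p + q < N)%N by lia.
have hL ic : ic \in graded_exponents covers t ->
    [/\ (ic.1 <= t)%N & ic.2 \in mnm_pow covers ic.1].
  rewrite mem_undup => /allpairsPdep[i [c [+ ci ->]]].
  by rewrite mem_iota => hi; split=> //=; lia.
suff inj : {in graded_exponents covers t &, injective r}.
  rewrite -(size_map r); move: (undup_uniq [seq (i, c) | i <- iota 0 t.+1, c <- mnm_pow covers i]).
  rewrite -/(graded_exponents covers t) -(map_inj_in_uniq inj) => /card_uniqP <-.
  by apply: leq_trans (max_card _) _; rewrite card_ffun !card_ord.
move=> [i c] [i' c'] /hL[/= it ci] /hL[/= it' ci'] /ffunP rE.
have cE v : (v < p + q)%N -> c v = c' v.
  move=> hv; have := congr1 val (rE (Ordinal hv)); rewrite !ffunE /=.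
  have -> : w (Ordinal hv) = v by apply: val_inj.
  by rewrite !inordK // ltnS; [apply: leq_trans it'|apply: leq_trans it];
    apply: squarefree_pow covers_squarefree _.
have iE : i = i'.
  have: (i * p = i' * p)%N.
    rewrite -(equigenerated_pow covers_left ci) -(equigenerated_pow covers_left ci').
    apply: eq_bigr => v _; have [hv|hv] := ltnP v (p + q); first by rewrite cE.
    by rewrite /left_weight leqNgt (leq_trans _ hv) //; lia.
  by move/eqP; rewrite eqn_pmul2r // => /eqP.
rewrite -iE in ci' *; congr (_, _); apply/mnmP => v.
have [hv|hv] := ltnP v (p + q); first exact: cE.
have -> : v = Ordinal last_ord by apply: val_inj => /=; have := ltn_ord v; lia.
have wE e : mnm_weight right_weight e = (e (Ordinal last_ord) +
    \sum_(u | u != Ordinal last_ord) right_weight u * e u)%N.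
  by rewrite /mnm_weight (bigD1 (Ordinal last_ord)) //= /right_weight leq_addr mul1n.
have := equigenerated_pow covers_right ci'.
rewrite -(equigenerated_pow covers_right ci) !wE.
have -> : (\sum_(u | u != Ordinal last_ord) right_weight u * c' u =
    \sum_(u | u != Ordinal last_ord) right_weight u * c u)%N.
  apply: eq_bigr => u ul; rewrite cE //; have := ltn_ord u.
  by move: ul; rewrite -(inj_eq val_inj) /=; lia.
by move/addIn.
Qed.

(* The chain of faces: successively require full exponent at vertices 1, 2, ..;
   vertices 0 and p + q stay free to complete a generator missing the next one. *)
Lemma covers_face_step s : (s < p + q)%N ->
  let Phi s := coord_face clique_weight (p + q) (fun v => (0 < v <= s)%N) in
  exists g, [/\ g \in covers, Phi s 1%N g & ~~ Phi s.+1 1%N g].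
Proof.
move=> hs Phi.
suff [g [gG g1 g0]] : exists g, [/\ g \in covers,
    forall v, (0 < v <= s)%N -> g v = 1%N & forall v, v = s.+1 :> nat -> g v = 0%N].
  exists g; split=> //.
    rewrite /Phi /coord_face (covers_clique gG) mul1n eqxx.
    by apply/forallP => v; apply/implyP => /g1 ->.
  have sN : (s.+1 < N)%N by lia.
  apply/negP => /andP[_ /forallP/(_ (Ordinal sN))].
  by rewrite /= leqnn g0.
(* The generator omits [s.+1] and a free vertex across the hub: [p + q] if [s.+1 < p], vertex 0 if
   [s.+1 > p]. If [s.+1 = p], it omits the hub alone. *)
have [sp|sp|sp] := ltngtP s.+1 p.
- exists (pair_cover s.+1 q.-1); split.
  + by apply/coversP; right; exists s.+1, q.-1; split=> //; lia.
  + by move=> v; rewrite pair_coverE; lia.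
  by move=> v; rewrite pair_coverE; lia.
- exists (pair_cover 0 (s.+1 - p.+1)); split.
  + by apply/coversP; right; exists 0%N, (s.+1 - p.+1)%N; split=> //; lia.
  + by move=> v; rewrite pair_coverE; lia.
  by move=> v; rewrite pair_coverE; lia.
exists hub_cover; split; first by apply/coversP; left.
  by move=> v; rewrite hub_coverE; lia.
by move=> v; rewrite hub_coverE; lia.
Qed.

Lemma covers_analytic_spread (k : fieldType) :
  has_analytic_spread (@monomial_ideal k N covers) (p + q).
Proof.
pose Phi s := coord_face clique_weight (p + q) (fun v => (0 < v <= s)%N).
apply: (@has_analytic_spread_faces k N _ clique_weight_gt0 _ _ covers_clique _ Phi).
- move=> s; exact: (coord_faceP clique_weight_gt0 covers_clique _ covers_squarefree).
- move=> s s' i c ss' /andP[wc /forallP h]; rewrite /Phi /coord_face wc.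
  apply/forallP => v; apply/implyP => vs; apply: (implyP (h v)); lia.
- exact: covers_face_step.
exact: size_graded_exponents.
Qed.

End TwoCliques.

(** * Counting generators *)

Lemma krull_dim_unique (R : comNzRingType) d e :
  has_krull_dim R d -> has_krull_dim R e -> d = e.
Proof.
move=> [[P Pc] Pb] [[Q Qc] Qb]; apply/eqP; rewrite eqn_leq.
by rewrite (Qb _ _ Pc) (Pb _ _ Qc).
Qed.

Lemma min_gens_unique (R : comNzRingType) (I : {pred R}) r s :
  has_min_gens I r -> has_min_gens I s -> r = s.
Proof.
move=> [[t <- It] rb] [[u <- Iu] sb]; apply/eqP; rewrite eqn_leq.
by rewrite (rb _ Iu) (sb _ It).
Qed.

(** Multisets of two indices below [n], grouped by the larger entry so that passing to [n.+1]
    appends one block. *)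
Definition sorted_pairs n :=
  flatten [seq [seq (i, j) | i <- iota 0 j.+1] | j <- iota 0 n].

Lemma mem_sorted_pairs n (ij : nat * nat) :
  (ij \in sorted_pairs n) = (ij.1 <= ij.2)%N && (ij.2 < n)%N.
Proof.
apply/flatten_mapP/idP => [[j]|/andP[h1 h2]].
  by rewrite mem_iota => hj /mapP[i]; rewrite mem_iota => hi -> /=; lia.
exists ij.2; first by rewrite mem_iota.
by apply/mapP; exists ij.1; [rewrite mem_iota|case: ij {h1 h2}].
Qed.

Lemma sorted_pairs_recr n :
  sorted_pairs n.+1 = sorted_pairs n ++ [seq (i, n) | i <- iota 0 n.+1].
Proof.
rewrite /sorted_pairs -[in LHS](addn1 n) iotaD map_cat flatten_cat.
by rewrite [iota (0 + n) 1]/= [flatten (map _ [:: _])]/= cats0.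
Qed.

Lemma size_sorted_pairs n : size (sorted_pairs n) = 'C(n.+1, 2).
Proof.
elim: n => [|n IH] //; rewrite sorted_pairs_recr size_cat size_map size_iota IH.
by rewrite [RHS]binS bin1 addnC.
Qed.

Lemma uniq_sorted_pairs n : uniq (sorted_pairs n).
Proof.
elim: n => [|n IH] //; rewrite sorted_pairs_recr cat_uniq IH andTb.
rewrite map_inj_uniq ?iota_uniq ?andbT; last by move=> x y [].
apply/hasPn => ij /mapP[i _ ->]; rewrite mem_sorted_pairs /=.
by rewrite ltnn andbF.
Qed.

(** Evaluation at the four indices shows that each entry of one pair occurs in the other; the
    ordering then forces equality. *)
Lemma sorted_pair_inj n a b c d :
  (a <= b)%N -> (b < n)%N -> (c <= d)%N -> (d < n)%N ->
  (forall v, (v < n)%N -> ((v != a) + (v != b) = (v != c) + (v != d))%N) ->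
  (a, b) = (c, d).
Proof.
move=> ab bn cd dn E; have aE := E a (leq_ltn_trans ab bn); have bE := E b bn.
have cE := E c (leq_ltn_trans cd dn); have dE := E d dn.
have ac : (a == c) || (a == d).
  by move: aE; rewrite eqxx; case: (a == c); case: (a == d); case: (a == b).
have cx : (c == a) || (c == b).
  by move: cE; rewrite eqxx; case: (c == a); case: (c == b); case: (c == d).
have bx : (b == c) || (b == d).
  by move: bE; rewrite eqxx; case: (b == c); case: (b == d); case: (b == a).
have dx : (d == a) || (d == b).
  by move: dE; rewrite eqxx; case: (d == a); case: (d == b); case: (d == c).
clear -ab cd ac bx cx dx; congr (_, _); lia.
Qed.

(** * Minimal generators of the ideal and of its square *)

Section Squares.
Variables p q : nat.
Hypotheses (p_gt0 : (0 < p)%N) (q_gt0 : (0 < q)%N).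
Local Notation N := (p.+1 + q)%N.
Local Notation hub := (hub_cover p q).
Local Notation pair := (pair_cover p q).

Lemma pair_cover_inj i j i' j' : (i < p)%N -> (j < q)%N -> (i' < p)%N -> (j' < q)%N ->
  pair i j = pair i' j' -> (i, j) = (i', j').
Proof.
move=> hi hj hi' hj' /mnmP E.
have iN : (i < N)%N by lia.
have jN : (p.+1 + j < N)%N by lia.
have := E (Ordinal iN); have := E (Ordinal jN); rewrite !pair_coverE /= => e1 e2.
by congr (_, _); lia.
Qed.

Definition indices := [seq (i, j) | i <- iota 0 p, j <- iota 0 q].

Lemma mem_indices ij : (ij \in indices) = (ij.1 < p)%N && (ij.2 < q)%N.
Proof.
apply/allpairsP/andP => [[[i j] /= []]|[h1 h2]].
  by rewrite !mem_iota => hi hj -> /=; lia.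
by exists ij; rewrite !mem_iota; case: ij h1 h2.
Qed.

Lemma uniq_indices : uniq indices.
Proof. by apply: allpairs_uniq; rewrite ?iota_uniq // => -[i j] [i' j'] _ _ /= [-> ->]. Qed.

Lemma covers_indices : covers p q = hub :: [seq pair ij.1 ij.2 | ij <- indices].
Proof. by rewrite /covers map_allpairs. Qed.

Lemma size_covers : size (covers p q) = (p * q).+1.
Proof. by rewrite /= size_allpairs !size_iota. Qed.

Lemma hub_vertex : exists w : 'I_N, w = p :> nat.
Proof.
have wp : (p < N)%N by lia.
by exists (Ordinal wp).
Qed.

Lemma pair_cover_hub (w : 'I_N) i j : w = p :> nat -> (i < p)%N -> pair i j w = 1%N.
Proof. by move=> wp ip; rewrite pair_coverE wp; lia. Qed.

Lemma hub_cover_hub (w : 'I_N) : w = p :> nat -> hub w = 0%N.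
Proof. by move=> wp; rewrite hub_coverE wp eqxx. Qed.

Lemma uniq_pairs : uniq [seq pair ij.1 ij.2 | ij <- indices].
Proof.
rewrite map_inj_in_uniq ?uniq_indices // => -[i j] [i' j'].
rewrite !mem_indices /= => /andP[hi hj] /andP[hi' hj'].
exact: pair_cover_inj.
Qed.

Lemma uniq_covers : uniq (covers p q).
Proof.
rewrite covers_indices /= uniq_pairs andbT.
have [w wp] := hub_vertex.
apply/mapP => -[[i j]]; rewrite mem_indices /= => /andP[ip _] /mnmP/(_ w).
by rewrite hub_cover_hub // pair_cover_hub.
Qed.

(* Two pair covers may exchange their vertices of one clique without changing
   the product, so both index pairs can be sorted independently. *)
Definition square_pairs :=
  [seq (pair ii.1 jj.1 + pair ii.2 jj.2)%MM | ii <- sorted_pairs p, jj <- sorted_pairs q].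

Definition squares :=
  (hub + hub)%MM :: [seq (hub + pair ij.1 ij.2)%MM | ij <- indices] ++ square_pairs.

Lemma size_squares : size squares = (1 + p * q + 'C(p.+1, 2) * 'C(q.+1, 2))%N.
Proof.
rewrite /= size_cat size_map !size_allpairs !size_iota !size_sorted_pairs.
by rewrite add1n addSn.
Qed.

(** Left and right vertices never coincide, so an exponent is 1 minus the two indicators of omitted
    vertices, and the sum sees only the omitted vertices with multiplicity. *)
Lemma pair_cover_swap i j i' j' :
  (i < p)%N -> (i' < p)%N ->
  (pair i j + pair i' j')%MM = (pair i j' + pair i' j)%MM.
Proof.
move=> hi hi'; apply/mnmP => v; rewrite !mnmDE !pair_coverE.
by case: eqP => ?; case: eqP => ?; case: eqP => ?; case: eqP => ?; lia.
Qed.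

Lemma squares_sub g h : g \in covers p q -> h \in covers p q -> (g + h)%MM \in squares.
Proof.
have hp i j : (i < p)%N -> (j < q)%N -> (hub + pair i j)%MM \in squares.
  move=> hi hj; rewrite inE mem_cat; apply/orP; right; apply/orP; left.
  by apply/mapP; exists (i, j); rewrite ?mem_indices ?hi ?hj.
have sp i j i' j' : (i <= i')%N -> (i' < p)%N -> (j <= j')%N -> (j' < q)%N ->
    (pair i j + pair i' j')%MM \in squares.
  move=> hi hi' hj hj'; rewrite inE mem_cat; apply/orP; right; apply/orP; right.
  apply/allpairsP; exists ((i, i'), (j, j')).
  by rewrite !mem_sorted_pairs /= hi hi' hj hj'.
move=> /coversP[->|[i [j [hi hj ->]]]] /coversP[->|[i' [j' [hi' hj' ->]]]].
- by rewrite mem_head.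
- exact: hp.
- by rewrite addmC; apply: hp.
have [ii|/ltnW ii] := leqP i i'; have [jj|/ltnW jj] := leqP j j'.
- exact: sp.
- by rewrite pair_cover_swap //; apply: sp.
- by rewrite addmC pair_cover_swap //; apply: sp.
by rewrite addmC; apply: sp.
Qed.

Lemma squares_pow : squares =i mnm_pow (covers p q) 2.
Proof.
move=> c; apply/idP/idP; last first.
  move=> /allpairsP[[g h] /= [gG /allpairsP[[h' z] /= [hG]]]].
  by rewrite inE => /eqP-> -> ->; rewrite addm0; apply: squares_sub.
have mem g h : g \in covers p q -> h \in covers p q ->
    (g + h)%MM \in mnm_pow (covers p q) 2.
  move=> gG hG; apply/allpairsP; exists (g, h); split=> //=.
  by apply/allpairsP; exists (h, 0%MM); split; rewrite ?mem_head ?addm0.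
have hG : hub \in covers p q by apply/coversP; left.
have pG i j : (i < p)%N -> (j < q)%N -> pair i j \in covers p q.
  by move=> hi hj; apply/coversP; right; exists i, j.
rewrite inE mem_cat => /or3P[/eqP->|/mapP[[i j]]|/allpairsP[[[i i'] [j j']] /= []]].
- exact: mem.
- by rewrite mem_indices /= => /andP[hi hj] ->; apply: mem => //; apply: pG.
rewrite !mem_sorted_pairs /= => /andP[hi hi'] /andP[hj hj'] ->.
by apply: mem; apply: pG; lia.
Qed.

(** The exponent at the hub, 0, 1 or 2, separates the three families. Within the last, the left and
    the right vertices recover the two sorted pairs independently. *)
Lemma uniq_squares : uniq squares.
Proof.
have [w wp] := hub_vertex.
have w1 c : c \in [seq (hub + pair ij.1 ij.2)%MM | ij <- indices] -> c w = 1%N.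
  case/mapP => -[i j]; rewrite mem_indices /= => /andP[hi _] ->.
  by rewrite mnmDE hub_cover_hub // pair_cover_hub.
have w2 c : c \in square_pairs -> c w = 2%N.
  case/allpairsP => -[[i i'] [j j']] /= [].
  rewrite !mem_sorted_pairs /= => /andP[hi hi'] _ ->.
  by rewrite mnmDE !pair_cover_hub //; lia.
rewrite cons_uniq mem_cat cat_uniq; apply/and4P; split.
- apply/negP => /orP[/w1|/w2]; by rewrite mnmDE hub_cover_hub.
- have := uniq_pairs; rewrite -(map_inj_uniq (@addmI _ hub)) -map_comp.
  by [].
- by apply/hasPn => c /w2 c2; apply/negP => /w1; rewrite c2.
apply: allpairs_uniq; rewrite ?uniq_sorted_pairs //.
move=> [[i1 i2] [j1 j2]] [[k1 k2] [l1 l2]].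
move=> /allpairsP[[[a1 a2] [b1 b2]] /= [+ + [-> -> -> ->]]].
rewrite !mem_sorted_pairs /= => /andP[hi hi'] /andP[hj hj'].
move=> /allpairsP[[[c1 c2] [d1 d2]] /= [+ + [-> -> -> ->]]].
rewrite !mem_sorted_pairs /= => /andP[hk hk'] /andP[hl hl'] /mnmP E.
have X v (hv : (v < p)%N) : ((v != a1) + (v != a2) = (v != c1) + (v != c2))%N.
  have vN : (v < N)%N by lia.
  have ne j : (v != p.+1 + j)%N by lia.
  by have := E (Ordinal vN); rewrite !mnmDE !pair_coverE /= !ne !andbT.
have Y v (hv : (v < q)%N) : ((v != b1) + (v != b2) = (v != d1) + (v != d2))%N.
  have vN : (p.+1 + v < N)%N by lia.
  have ne i : (i < p)%N -> (p.+1 + v != i)%N by lia.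
  have := E (Ordinal vN); rewrite !mnmDE !pair_coverE /= !eqn_add2l.
  by rewrite !ne ?(leq_ltn_trans hi) ?(leq_ltn_trans hk).
by rewrite (sorted_pair_inj hi hi' hk hk' X) (sorted_pair_inj hj hj' hl hl' Y).
Qed.

Lemma covers_min_gens (k : fieldType) :
  has_min_gens (@monomial_ideal k N (covers p q)) (p * q).+1.
Proof.
rewrite -size_covers.
exact: (has_min_gens_monomial k (@clique_weight_gt0 p q) uniq_covers
  (covers_clique p_gt0 q_gt0)).
Qed.

Lemma squares_min_gens (k : fieldType) :
  has_min_gens (ideal_exp (@monomial_ideal k N (covers p q)) 2)
    (1 + p * q + 'C(p.+1, 2) * 'C(q.+1, 2)).
Proof.
rewrite ideal_exp_monomial -(eq_monomial_ideal _ squares_pow) -size_squares.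
apply: (has_min_gens_monomial k (@clique_weight_gt0 p q) uniq_squares (d := (2 * (p + q))%N)).
move=> g; rewrite squares_pow; apply: equigenerated_pow.
exact: covers_clique.
Qed.

End Squares.

(** * The numerical Freiman identity *)

Lemma bin2_double n : ('C(n, 2) * 2 = n * n.-1)%N.
Proof. by rewrite bin2 muln2 -[RHS]odd_double_half oddM; case: n => //= n; case: odd. Qed.

(* Four times the difference of the two sides is (p-1)(p-2)(q-1)(q-2). *)
Lemma freiman_count p q : (0 < p)%N -> (p <= q)%N ->
  ((1 + p * q + 'C(p.+1, 2) * 'C(q.+1, 2))%N%:Z =
     (p + q)%N%:Z * (p * q).+1%:Z - 'C(p + q, 2)%N%:Z) <-> (p <= 2)%N.
Proof.
move=> p0 pq.
have := bin2_double p.+1; have := bin2_double q.+1; have := bin2_double (p + q).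
set A := 'C(p + q, 2); set B := 'C(q.+1, 2); set C := 'C(p.+1, 2).
move: A B C => A B C hA hB hC.
(* This turns the product of two binomials into a polynomial in [p] and [q]. *)
have hCB : (C * B * 4 = p.+1 * p * (q.+1 * q))%N.
  by rewrite -hB -hC mulnACA.
case: p p0 pq hA hC hCB => [//|[|[|p]]] _ pq /= hA hC hCB.
- by split=> // _; rewrite /= in hB; lia.
- by split=> // _; rewrite /= in hB; lia.
case: q pq hA hB hCB => [|[|[|q]]] //= pq hA hB hCB; split=> // E.
(* Here [p] and [q] stand for the original values minus 3, so this product is the difference of the
   two sides times four; it is visibly positive. *)
have : (p.+2 * p.+1 * (q.+2 * q.+1) = 0)%N by lia.
by [].
Qed.

Local Close Scope ring_scope.

Theorem theorem5p2 (k : fieldType) (n m : nat) (hn : 2 <= n) (hnm : n <= m) :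
  let I : {pred {mpoly k[n + m.-1]}} := cover_ideal k (Agraph n m) in
  quasi_equigenerated I /\
  has_analytic_spread I (n + m - 2) /\
  (freiman I <-> n <= 3).
Proof.
case: n hn hnm => // p p0; case: m => // q pq I.
have q0 : 0 < q := leq_trans p0 pq.
have -> : I = monomial_ideal (covers p q) by apply: cover_ideal_covers.
have -> : p.+1 + q.+1 - 2 = p + q by lia.
have qe := quasi_equigenerated_monomial k (@clique_weight_gt0 p q)
  (@covers_clique p q p0 q0).
have sp := covers_analytic_spread p0 q0 k.
have mu := covers_min_gens p0 q0 k.
have mu2 := squares_min_gens p0 q0 k.
split=> //; split=> //; rewrite ltnS -(freiman_count p0 pq).
(* The analytic spread and both generator counts are uniquely determined, so the Freiman condition
   is the identity of [freiman_count]. *)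
split=> [[_ [l [r [r2 [hl hr hr2 E]]]]]|E].
  by move: E; rewrite (krull_dim_unique hl sp) (min_gens_unique hr mu)
    (min_gens_unique hr2 mu2).
by split=> //; exists (p + q), (p * q).+1, (1 + p * q + 'C(p.+1, 2) * 'C(q.+1, 2)).
Qed.
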